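(* Let $\mathcal{F}$ be a $\Delta$-filter on a semigroup $G$ and let $(e_g)_{g\in G}$ be a bounded family in a Hilbert space $\mathcal{H}$ such that the map $g\mapsto e_g$ is weakly $\Delta_\mathcal{F}$-measurable, i.e. for every $f\in\mathcal{H}$ and $\varepsilon>0$, the set $\{g\in G : \langle e_g,f\rangle \ge \varepsilon\}$ is $\Delta_\mathcal{F}$-measurable. If $$\lim_{h\to\mathcal{F}}\lim_{g\to\mathcal{F}} \langle e_g, e_{gh}\rangle = 0,$$ then $\lim_{g\to\mathcal{F}} e_g = 0$ weakly, i.e. $\lim_{g\to\mathcal{F}}\langle e_g,f\rangle = 0$ for every $f\in\mathcal{H}$.
   Context: A filter $\mathcal{F}$ on a set $S$ is a nonempty family of subsets of $S$ not containing $\emptyset$, closed upward and under finite intersections; $A$ is $\mathcal{F}$-large if $A\in\mathcal{F}$, $\mathcal{F}$-small if $S\setminus A\in\mathcal{F}$, $\mathcal{F}$-positive if not $\mathcal{F}$-small. ''$\exists^\mathcal{F} x \in B\, P(x)$'' means the set of $x\in B$ with $P(x)$ is $\mathcal{F}$-positive. For a family $(x_s)_{s\in S}$ in a topological space, $\lim_{s\to\mathcal{F}} x_s = x$ means for every open neighborhood $U$ of $x$, $\{s : x_s\in U\}$ is $\mathcal{F}$-large. $A\sim_\mathcal{F} B$ means $A\triangle B$ is $\mathcal{F}$-small; $\tilde A \precsim_\mathcal{F} A$ means $\tilde A\sim_\mathcal{F} A$ and $\tilde A\subseteq A$. For a semigroup $G$, $Ag^{-1} := \{h : hg\in A\}$,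 $\partial_g A := A\cap Ag^{-1}$. Recurrence w.r.t. $\mathcal{F}$: $A$ is $0$-recurrent if $\mathcal{F}$-positive; $\Delta^0(A)=A$; for $n\ge1$, $\Delta^n(A):=\{g : \partial_g A \text{ is } (n-1)\text{-recurrent}\}$ and $A$ is $n$-recurrent if $\Delta^n(A)$ is $\mathcal{F}$-positive; $\Delta(A)=\Delta^1(A)$. $A$ is $\infty$-recurrent if $n$-recurrent for all $n$, and $\Delta_\mathcal{F}$-measurable if it is $\mathcal{F}$-small or $\infty$-recurrent. $\mathcal{F}$ respects recurrence if for all $n\ge1$ and $A\sim_\mathcal{F}\tilde A$, $A$ is $n$-recurrent iff $\tilde A$ is. $D$ is $0$-thick in $\Delta(A)$ always; for $n\ge1$, $D$ is $n$-thick in $\Delta(A)$ if for every $n$-recurrent $\tilde A\precsim_\mathcal{F} A$, $\exists^\mathcal{F} g\in D$ with $\partial_g\tilde A$ $(n-1)$-recurrent and $\partial_g D$ $(n-1)$-thick in $\Delta(\partial_g\tilde A)$. A $\Delta$-filter is a filter respecting recurrence such that every $\mathcal{F}$-large set is $n$-thick in $\Delta(A)$ for all $A\subseteq G$, $n\ge0$. *)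

(* Defs.v *)
From HB Require Import structures.
From mathcomp Require Import all_boot all_order all_algebra.
From mathcomp Require Import sesquilinear complex.
From mathcomp Require Import all_classical all_reals all_analysis.

Set Implicit Arguments.
Unset Strict Implicit.
Unset Printing Implicit Defensive.

Import Order.TTheory GRing.Theory Num.Theory.
Import numFieldNormedType.Exports.

Local Open Scope classical_set_scope.
Local Open Scope ring_scope.

Section FilterNotions.
Context {S : Type}.
Implicit Types (F : set_system S) (A B : set S).

Definition large F A : Prop := F A.
Definition small F A : Prop := F (~` A).
Definition positive F A : Prop := ~ small F A.

Definition sim F A B : Prop := small F (A `+` B).

Definition precsim F A' A : Prop := sim F A' A /\ A' `<=` A.

End FilterNotions.

Section Recurrence.
Context {G : semigroupType}.
Implicit Types (F : set_system G) (A D : set G).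

(* The right translate A g^-1; no inverse of g is involved. *)
Definition rtrans A (g : G) : set G := [set h | A (h * g)%g].

Definition partial (g : G) A : set G := A `&` rtrans A g.

(* For n >= 1 the mutual recursion between Delta^n and n-recurrence unfolds to
   this; the case n = 0 reads "A is F-positive". *)
Fixpoint recurrent F (n : nat) A : Prop :=
  if n is m.+1 then positive F [set g | recurrent F m (partial g A)]
  else positive F A.

Definition Delta F (n : nat) A : set G :=
  if n is m.+1 then [set g | recurrent F m (partial g A)] else A.

Lemma recurrentE F n A : recurrent F n A = positive F (Delta F n A).
Proof. by case: n. Qed.

Definition infty_recurrent F A : Prop := forall n, recurrent F n A.

Definition Delta_measurable F A : Prop := small F A \/ infty_recurrent F A.

Definition respects_recurrence F : Prop :=
  forall (n : nat) A A', (1 <= n)%N -> sim F A A' ->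
    (recurrent F n A <-> recurrent F n A').

(* [thick F n D A] is "D is n-thick in Delta(A)". *)
Fixpoint thick F (n : nat) D A : Prop :=
  if n is m.+1 then
    forall A', recurrent F m.+1 A' -> precsim F A' A ->
      positive F [set g | [/\ D g, recurrent F m (partial g A')
                            & thick F m (partial g D) (partial g A')]]
  else True.

Definition Delta_filter F : Prop :=
  [/\ ProperFilter F, respects_recurrence F
    & forall D, large F D -> forall A n, thick F n D A].

End Recurrence.

(* The two possible scalar fields of a Hilbert space, with the involution for
   which its inner product is hermitian. *)
Variant real_or_complex (R : realType) :
    forall K : numFieldType, (K -> K) -> Prop :=
| RealScalars : @real_or_complex R R idfun
| ComplexScalars : @real_or_complex R R[i] Num.conj.

(* z itself over the reals, the real part of z over the complex numbers. *)
Definition re_part (K : numFieldType) (conj : K -> K) (z : K) : K :=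
  (z + conj z) / 2.

(* Main.v *)
Require Import Defs.
From HB Require Import structures.
From mathcomp Require Import all_boot all_order all_algebra.
From mathcomp Require Import sesquilinear complex ring.
From mathcomp Require Import all_classical all_reals all_analysis.

Set Implicit Arguments.
Unset Strict Implicit.
Unset Printing Implicit Defensive.

Import Order.TTheory GRing.Theory Num.Theory.
Import numFieldNormedType.Exports.

Local Open Scope classical_set_scope.
Local Open Scope ring_scope.

(* If Re <e_g, f> >= eps on an F-positive set A, then A is n-recurrent for
   every n.  For a fixed tolerance d, the set D of those h for which
   |<e_g, e_(gh)>| <= d for F-almost all g is large, hence n-thick in Delta(A).
   Thickness yields h_1, .., h_n, with all products h_j h_(j-1) .. h_i (i <= j)
   in D, such that many g have g, g h_n, g h_n h_(n-1), .. all in A; discarding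
   an F-small set of g at every step makes the corresponding vectors pairwise
   d-orthogonal.  Their sum v then satisfies |v|^2 = O(n) + n^2 d while
   Re <v, f> >= n eps, which is impossible for d small and n large. *)

(** * Equivalence modulo small sets and positivity *)

Section FilterLemmas.
Context {S : Type} (F : set_system S) {FF : Filter F}.
Implicit Types A B C : set S.

Lemma positive_nonempty A : positive F A -> A !=set0.
Proof.
move=> Apos; apply: contrapT => A0; apply: Apos.
by apply: (@filterS _ F) filterT => x _ Ax; apply: A0; exists x.
Qed.

Lemma sim_trans A B C : sim F A B -> sim F B C -> sim F A C.
Proof.
rewrite /sim /small => AB BC; apply: (@filterS _ F) (filterI AB BC) => x [nAB nBC].
move=> [[Ax nCx]|[Cx nAx]].
- by have [Bx|nBx] := pselect (B x); [apply: nBC; left | apply: nAB; left].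
- by have [Bx|nBx] := pselect (B x); [apply: nAB; right | apply: nBC; right].
Qed.

Lemma precsim_trans A B C : precsim F A B -> precsim F B C -> precsim F A C.
Proof.
by move=> [AB sAB] [BC sBC]; split; [apply: sim_trans BC | apply: subset_trans sBC].
Qed.

Lemma precsim_setIl A B : large F B -> precsim F (A `&` B) A.
Proof.
move=> FB; split; last exact: subIsetl.
by apply: (@filterS _ F) FB => x Bx [[[Ax _] /(_ Ax)]|[Ax]]; last by apply.
Qed.

Lemma positive_sim A B : sim F A B -> positive F A -> positive F B.
Proof.
rewrite /positive /sim /small => AB Apos nB; apply: Apos.
by apply: (@filterS _ F) (filterI AB nB) => x [nAB nBx] Ax; apply: nAB; left.
Qed.

Lemma filter_all (I : eqType) (P : S -> I -> bool) (s : seq I) :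
  {in s, forall i, F [set x | P x i]} -> F [set x | all (P x) s].
Proof.
elim: s => [_|i s IHs FP]; first by apply: (@filterS _ F) filterT.
have Fi := FP i (mem_head i s).
have Fs : F [set x | all (P x) s].
  by apply: IHs => j js; apply: FP; rewrite inE js orbT.
by apply: filterS (filterI Fi Fs) => x [/= -> ->].
Qed.

End FilterLemmas.

(** * Extracting pairwise related elements from recurrence *)

Section Ramsey.
Context {G : semigroupType} (F : set_system G).
Implicit Types (A D : set G) (n : nat).

Lemma recurrent_sim n A A' : Filter F -> respects_recurrence F ->
  sim F A A' -> recurrent F n A -> recurrent F n A'.
Proof.
move=> FF Frec; case: n => [|n] AA'; first exact: (positive_sim AA').
by have [] := Frec n.+1 A A' isT AA'.
Qed.

(** By transitivity of [precsim], every set tested for [A'] is also tested for [A]. *)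
Lemma thick_precsim n D A A' : Filter F ->
  precsim F A' A -> thick F n D A -> thick F n D A'.
Proof.
move=> FF; case: n => // n A'A thD B Brec BA'.
by apply: thD => //; apply: precsim_trans A'A.
Qed.

(* The tuples being built are [g, g p_1, .., g p_k] for [g] ranging over the
   current set [A]; each step prepends a new base point and turns the list
   [p_1, .., p_k] into [h, h p_1, .., h p_k], so that [D] has to control the
   left translates of this list. *)
Lemma thick_ramsey_step (E : rel G) (A0 : set G) n A D (ps : seq G) :
  Filter F -> respects_recurrence F -> recurrent F n A -> thick F n D A ->
  (forall g, A g -> pairwise E (g :: [seq (g * p)%g | p <- ps]) /\
     {in g :: [seq (g * p)%g | p <- ps], forall x, A0 x}) ->
  (forall h, D h ->
     {in h :: [seq (h * p)%g | p <- ps], forall p, F [set g | E g (g * p)%g]}) ->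
  exists s : seq G,
    [/\ size s = (n + size ps).+1, {in s, forall x, A0 x} & pairwise E s].
Proof.
move=> FF Frec; elim: n A D ps => [|n IHn] A D ps Arec Dthick goodA goodD.
  have [g Ag] := positive_nonempty Arec; have [Eg A0g] := goodA g Ag.
  by exists (g :: [seq (g * p)%g | p <- ps]); rewrite /= size_map add0n.
have AA : precsim F A A.
  by split=> //; apply: (@filterS _ F) filterT => x _ [[]|[]] //.
have [h [Dh hrec hthick]] := positive_nonempty (Dthick A Arec AA).
(* For [g] in [partial h A], the old tuple based at [g h], preceded by [g], is the tuple of [qs]
   based at [g]. Membership in [B] supplies the new relations, those between [g] and the rest. *)
pose qs := h :: [seq (h * p)%g | p <- ps].
pose B := [set g | all (fun q => E g (g * q)%g) qs].
have FB : F B by apply: filter_all; apply: goodD.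
have AB := @precsim_setIl _ F FF (partial h A) B FB.
have mapqs g : [seq (g * q)%g | q <- qs] =
    (g * h)%g :: [seq (g * h * p)%g | p <- ps].
  by rewrite /= -map_comp; congr cons; apply: eq_map => p /=; rewrite mulgA.
have [|g [[Ag Agh] Bg]|k [Dk Dkh]|s [ss A0s Es]] :=
    IHn (partial h A `&` B) (partial h D) qs _ (thick_precsim FF AB hthick).
- apply: recurrent_sim hrec => //; have [simAB _] := AB.
  by rewrite /sim setYC.
- have [_ A0g] := goodA g Ag; have [Egh A0gh] := goodA _ Agh.
  split; last first.
    move=> x; rewrite mapqs inE => /orP[/eqP ->|]; last exact: A0gh.
    by apply: A0g; exact: mem_head.
  by rewrite pairwise_cons all_map; apply/andP; split; [exact: Bg|rewrite mapqs].
- move=> p; rewrite mapqs inE => /orP[/eqP ->|]; last exact: goodD.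
  by apply: goodD Dk _ _; exact: mem_head.
- by exists s; split=> //; rewrite ss /= size_map addnS.
Qed.

Lemma Delta_filter_ramsey (E : rel G) A n : Delta_filter F ->
  recurrent F n A -> (\forall h \near F, F [set g | E g (g * h)%g]) ->
  exists s : seq G, [/\ size s = n.+1, {in s, forall x, A x} & pairwise E s].
Proof.
move=> [FF Frec Fthick] Arec FE.
have [||s] := @thick_ramsey_step E A n A _ [::] _ Frec Arec (Fthick _ FE A n).
- by move=> g Ag; split=> // x; rewrite inE => /eqP ->.
- by move=> h Dh p; rewrite inE => /eqP ->.
- by rewrite addn0; exists s.
Qed.

End Ramsey.

(** * Real and complex scalars treated together *)

Section Scalars.
Context {R : realType} {K : numFieldType} {conj : K -> K}.
Hypothesis hK : real_or_complex R conj.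

Lemma scalar_conj_id (x : K) : 0 <= x -> conj x = x.
Proof.
by case: hK x => // x x0; apply: conj_Creal; exact: ger0_real.
Qed.

Lemma scalar_archi (x : K) : 0 <= x -> exists n : nat, x < n%:R.
Proof.
case: hK x => x x0.
  by exists (Num.truncn x).+1; exact: truncnS_gt.
have /complex_realP[r rE] : x \is Num.real by exact: ger0_real.
exists (Num.truncn r).+1; rewrite rE -(rmorph_nat (real_complex R)) ltcR.
exact: truncnS_gt.
Qed.

Lemma re_part_real (z : K) : re_part conj z \is Num.real.
Proof.
case: hK z => z; first exact: num_real.
by have := Creal_Re z; rewrite ReE.
Qed.

Lemma re_part_le_norm (z : K) : re_part conj z <= `|z|.
Proof.
have zz : `|z + conj z| <= `|z| + `|z|.
  apply: le_trans (ler_normD _ _) _; rewrite lerD2l.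
  by case: hK z => z; rewrite ?norm_conjC.
apply: le_trans (real_ler_norm (re_part_real z)) _.
by rewrite /re_part normrM normfV normr_nat ler_pdivrMr // mulr_natr mulr2n.
Qed.

(** Over the complex numbers [a] is the imaginary unit, so the last two bounds control the imaginary
    part; over the reals [a = 0] and they only say [0 < d]. The factor [conj a] is what [dot]
    produces from a vector [a *: f] on the right. *)
Lemma norm_lt_re_part : exists a : K, forall z d : K,
  re_part conj z < d -> re_part conj (- z) < d ->
  re_part conj (conj a * z) < d -> re_part conj (- (conj a * z)) < d ->
  `|z| < d + d.
Proof.
case: hK => [|].
  have reE (w : R) : re_part idfun w = w by rewrite /re_part /=; field.
  exists 0 => z d; rewrite !reE mul0r oppr0 => zd nzd d0 _.
  apply: lt_trans (_ : d < _); last by rewrite ltrDl.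
  by rewrite ltr_norml ltrNl nzd.
exists 'i%R => z d; have reE (w : R[i]) : re_part Num.conj w = 'Re w.
  by rewrite ReE.
rewrite !reE conjCi !raddfN /= mulNr !raddfN /= ReMil !opprK.
move=> h1 h2 h3 h4; rewrite [z in `|z|]Crect.
apply: le_lt_trans (ler_normD _ _) _; rewrite normrM normCi mul1r.
by apply: ltrD; rewrite real_ltr_norml ?Creal_Re ?Creal_Im // ltrNl; apply/andP.
Qed.

End Scalars.

(** * Inner product estimates for finite sums *)

Section InnerProduct.
Context {R : realType} {K : numFieldType} {conj : K -> K}.
Hypothesis hK : real_or_complex R conj.
Context {U : lmodType K} (dot : {dot U for conj}).
Implicit Types u v f : U.

Lemma dotC u v : conj (dot u v) = dot v u.
Proof. by rewrite (hermitian_subproof v u) expr0 mul1r. Qed.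

Lemma re_part_dot2 u v : re_part conj (dot u v) * 2 = dot u v + dot v u.
Proof. by rewrite /re_part dotC divfK // pnatr_eq0. Qed.

Lemma re_part_dotDl u v f :
  re_part conj (dot (u + v) f) = re_part conj (dot u f) + re_part conj (dot v f).
Proof. by rewrite /re_part !dotC -mulrDl (linearDl dot) (linearDr dot) /= addrACA. Qed.

Lemma dot_ge0 u : 0 <= dot u u.
Proof.
have [->|u0] := eqVneq u 0; first by rewrite linear0l.
by rewrite ltW // neq0_dnorm_gt0.
Qed.

(** Expand the nonnegative square of [v - t *: f]. *)
Lemma dot_young t v f : 0 <= t ->
  t * (re_part conj (dot v f) * 2) <= dot v v + t ^+ 2 * dot f f.
Proof.
move=> t0; have h := dot_ge0 (v - t *: f).
rewrite linearBl !linearBr /= !linearZr_LR /= !linearZl_LR /= in h.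
rewrite (scalar_conj_id hK t0) in h; rewrite -subr_ge0 re_part_dot2.
by move: h; congr (is_true (0 <= _)); ring.
Qed.

Context {I : eqType} (x : I -> U).

Lemma re_part_dot_sum_ge (s : seq I) f eps :
  {in s, forall i, eps <= re_part conj (dot (x i) f)} ->
  (size s)%:R * eps <= re_part conj (dot (\sum_(i <- s) x i) f).
Proof.
elim: s => [_|i s IHs epsx].
  by rewrite big_nil mul0r /re_part dotC linear0l linear0r addr0 mul0r.
rewrite big_cons re_part_dotDl /= -natr1 mulrDl mul1r addrC lerD ?epsx ?mem_head //.
by apply: IHs => j js; apply: epsx; rewrite inE js orbT.
Qed.

Lemma dot_sum_le (C d : K) (s : seq I) : 0 <= d ->
  (forall i, dot (x i) (x i) <= C) ->
  pairwise (fun i j => `|dot (x i) (x j)| <= d) s ->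
  dot (\sum_(i <- s) x i) (\sum_(i <- s) x i) <=
    (size s)%:R * C + (size s)%:R ^+ 2 * d.
Proof.
move=> d0 xC; elim: s => [_|i s IHs].
  by rewrite big_nil linear0l mul0r expr0n mul0r addr0.
rewrite pairwise_cons big_cons => /andP[/allP/= id /IHs {IHs}].
set v := \sum_(j <- s) x j => IHs.
have ivd : `|dot (x i) v| <= (size s)%:R * d.
  rewrite linear_sumr /=; apply: le_trans (ler_norm_sum _ _ _) _.
  rewrite big_seq; apply: le_trans (ler_sum _ id) _.
  by rewrite -big_seq big_const_seq count_predT iter_addr_0 mulr_natl.
have cross : dot (x i) v + dot v (x i) <= (size s)%:R * d * 2.
  by rewrite -re_part_dot2 ler_wpM2r // (le_trans (re_part_le_norm hK _)).
rewrite (linearDl dot) !(linearDr dot) /=.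
have -> : dot (x i) (x i) + dot (x i) v + (dot v (x i) + dot v v) =
  dot (x i) (x i) + (dot (x i) v + dot v (x i)) + dot v v by ring.
apply: le_trans (lerD (lerD (xC i) cross) IHs) _.
(* With k the size of [s], the slack is (k+1)^2 d - k^2 d - 2 k d = d. *)
by rewrite -subr_ge0 -natr1 [leRHS](_ : _ = d) //; ring.
Qed.

End InnerProduct.

Theorem mainTheorem2
  (G : semigroupType) (F : set_system G) (hF : Delta_filter F)
  (R : realType) (K : numFieldType) (conj : K -> K)
  (hK : real_or_complex R conj)
  (H : completeNormedModType K) (dot : {dot H for conj})
  (hdot : forall x : H, dot x x = `|x| ^+ 2)
  (e : G -> H) (he : [bounded e g | g in [set: G]])
  (hmeas : forall (f : H) (eps : K), 0 < eps ->
     Delta_measurable F [set g | eps <= re_part conj (dot (e g) f)])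
  (L : G -> K)
  (hL : \forall h \near F, dot (e g) (e (g * h)%g) @[g --> F] --> L h)
  (hL0 : L h @[h --> F] --> (0 : K)) :
  forall f : H, dot (e g) f @[g --> F] --> (0 : K).
Proof.
have [FF _ _] := hF.
have [M M0 eM] := pinfty_ex_gt0 he.
have eC g : dot (e g) (e g) <= M ^+ 2.
  by rewrite hdot lerXn2r ?nnegrE ?normr_ge0 ?(ltW M0) //; exact: eM.
have near_orth (d : K) : 0 < d ->
    \forall h \near F, F [set g | `|dot (e g) (e (g * h)%g)| <= d].
  move=> d0; have d20 : 0 < d / 2 by rewrite divr_gt0.
  have FL : \forall h \near F, `|L h| < d / 2.
    exact: cvgr0_norm_lt hL0 _ d20.
  move: hL FL; apply: filterS2 => h hh Lh.
  have Fd : \forall g \near F, `|L h - dot (e g) (e (g * h)%g)| < d / 2.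
    exact: cvgr_dist_lt hh _ d20.
  apply: filterS Fd => g /= dg; rewrite (splitr d).
  rewrite -[dot _ _](subKr (L h)); apply: le_trans (ler_normB _ _) _.
  by rewrite ltW // ltrD.
have re_small (f : H) (eps : K) : 0 < eps ->
    \forall g \near F, re_part conj (dot (e g) f) < eps.
  move=> eps0; have [sm|rec] := hmeas f eps eps0.
    apply: (@filterS _ F) sm => g /= /negP.
    by rewrite -real_ltNge ?(gtr0_real eps0) ?(re_part_real hK).
  (* [dot_young] will be used with [t = m * c], m being the number of vectors. The [+ 1] allows
     [f = 0] and still gives [c * dot f f <= eps]. *)
  exfalso; pose c := eps / (dot f f + 1); pose d := c * eps / 2.
  have f1 : 0 < dot f f + 1 by rewrite ltr_wpDl // dot_ge0.
  have c0 : 0 < c by rewrite divr_gt0.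
  have d0 : 0 < d by rewrite divr_gt0 // mulr_gt0.
  have cf : c * dot f f <= eps.
    by rewrite mulrAC ler_pdivrMr // ler_wpM2l ?(ltW eps0) // lerDl.
  have [|n nM] := scalar_archi hK (x := M ^+ 2 / d).
    by rewrite divr_ge0 ?exprn_ge0 // ltW.
  pose E : rel G := fun x y => `|dot (e x) (e y)| <= d.
  have [s [ss sA sE]] := Delta_filter_ramsey (E := E) hF (rec n) (near_orth d d0).
  pose m : K := (size s)%:R; pose v := \sum_(g <- s) e g.
  have m0 : 0 < m by rewrite ltr0n ss.
  have vf : m * eps <= re_part conj (dot v f) by exact: re_part_dot_sum_ge.
  have vv : dot v v <= m * M ^+ 2 + m ^+ 2 * d.
    by apply: (dot_sum_le hK) => //; exact: ltW.
  have mc0 : 0 <= m * c by rewrite mulr_ge0 // ltW.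
  have ff : (m * c) ^+ 2 * dot f f <= m ^+ 2 * (c * eps).
    rewrite exprMn -mulrA ler_wpM2l ?exprn_ge0 ?(ltW m0) //.
    by rewrite expr2 -mulrA ler_wpM2l // ltW.
  have /le_trans/(_ (lerD vv ff)) := dot_young hK dot v f mc0.
  move/(le_trans (ler_wpM2l mc0 (ler_wpM2r (ler0n K 2) vf))).
  (* As [c * eps = 2 d], this reads [4 m^2 d <= m M^2 + 3 m^2 d]. *)
  rewrite -subr_ge0 (_ : _ - _ = m * (M ^+ 2 - m * d)); last first.
    by rewrite /d; field.
  rewrite pmulr_rge0 // subr_ge0 -ler_pdivlMr // => mM.
  (* Here [m] is n + 1, yet the estimate gives m <= M^2 / d < n. *)
  have := le_lt_trans mM nM; rewrite ltr_nat ss ltnNge => /negP[].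
  exact: leqnSn.
move=> f; have [a na] := norm_lt_re_part hK.
apply/cvgr0Pnorm_lt => eps eps0; have d0 : 0 < eps / 2 by rewrite divr_gt0.
(* One-sided bounds on real parts suffice once tested against [f], [a *: f] and their opposites. *)
have F1 := re_small f _ d0; have F2 := re_small (- f) _ d0.
have F3 := re_small (a *: f) _ d0; have F4 := re_small (- (a *: f)) _ d0.
apply: (@filterS _ F) (filterI (filterI F1 F2) (filterI F3 F4)) => g /=.
rewrite !linearNr !linearZr_LR /= => -[[h1 h2] [h3 h4]].
by rewrite (splitr eps); exact: na.
Qed.
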